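(* Let $Z(t)=X_1+\dots+X_t$, $t\in\mathbb{N}$ (with $Z(0)=0$), be a random walk whose increments are i.i.d. copies of a real random variable $X$ that is not almost surely constant and takes both positive and negative values with positive probability. Let $\varphi(\lambda)=\mathbb{E}[e^{\lambda X}]$, $\psi=\log\varphi$, $\Lambda=\{\lambda\in\mathbb{R}:\varphi(\lambda)<+\infty\}$ and $\Lambda_+=(0,+\infty)\cap\operatorname{int}(\Lambda)$. Assume that $\Lambda_+$ is non-empty, that $\varphi$ is at least twice differentiable in $\Lambda_+$, and that there exists $\lambda^*\in\Lambda_+$ with $\psi(\lambda^* )=0$. Let $B$ belong to the class $L(\lambda)$ for some $\lambda\in\Lambda_+$. Then for every integer $N\ge 2$, $$\lim_{x\to+\infty}\frac{\mathbb{P}\left(\tau^{(N)}(x)\le \frac{B(x)}{N}\right)}{\mathbb{P}\left(\tau(x)\le B(x)\right)}=\begin{cases} N, & \text{if } N\psi'(\lambda)<\psi'(\lambda^* ),\\ 0, & \text{if } N\psi'(\lambda)>\psi'(\lambda^* ).\end{cases}$$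
   Context: $\tau(x)=\inf\{t\ge 0: Z(t)\ge x\}$ is the first time the walk reaches level $x$. $\tau^{(N)}(x)=\min\{\tau_1(x),\dots,\tau_N(x)\}$, where $\tau_1(x),\dots,\tau_N(x)$ are independent random times each distributed as $\tau(x)$ (the first time any of $N$ independent copies of the walk reaches level $x$). For $\lambda\in\Lambda_+$, $L(\lambda)$ is the set of functions $f:\mathbb{R}\to\mathbb{R}$ such that $x=\psi'(\lambda)\,f(x)+o\left(\sqrt{f(x)}\right)$ as $x\to+\infty$. *)

(* Defs.v *)
From HB Require Import structures.
From mathcomp Require Export all_boot all_order all_algebra.
From mathcomp Require Export finmap.
From mathcomp Require Export all_classical all_reals all_analysis.
From mathcomp Require Export measurable_realfun.

Set Implicit Arguments.
Unset Strict Implicit.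
Unset Printing Implicit Defensive.

Export Order.TTheory GRing.Theory Num.Theory.
Export numFieldNormedType.Exports.

#[export] Set Implicit Arguments.
#[export] Unset Strict Implicit.
#[export] Unset Printing Implicit Defensive.

Local Open Scope ring_scope.
Local Open Scope classical_set_scope.

Canonical pinfty_filter_on (R : realType) :=
  FilterType (pinfty_nbhs R) (@filter_filter _ _ proper_pinfty_nbhs).

Definition mutually_independent (d d' : measure_display)
    (T : measurableType d) (T' : measurableType d') (R : realType)
    (P : probability T R) (I : choiceType) (X : I -> T -> T') : Prop :=
  forall (J : {fset I}) (A : I -> set T'), (forall i, measurable (A i)) ->
    P (\bigcap_(i in [set` J]) (X i @^-1` A i)) =
    (\prod_(i <- J) P (X i @^-1` A i))%E.

Definition same_law (d d' : measure_display)
    (T : measurableType d) (T' : measurableType d') (R : realType)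
    (P : probability T R) (X Y : T -> T') : Prop :=
  forall A : set T', measurable A -> pushforward P X A = pushforward P Y A.

(* The increments are numbered from 0: `xi i` is the (i+1)-st step. *)
Definition walk (T : Type) (R : realType) (xi : nat -> T -> R) (t : nat)
    (w : T) : R :=
  \sum_(i < t) xi i w.

(* Extended-real valued: the value is +oo when the level is never reached. *)
Definition hitting_time (T : Type) (R : realType) (Z : nat -> T -> R) (x : R)
    (w : T) : \bar R :=
  ereal_inf [set (t%:R)%:E | t in [set t : nat | x <= Z t w]].

Definition min_time (T : Type) (R : realType) (N : nat)
    (tau : 'I_N -> T -> \bar R) (w : T) : \bar R :=
  \big[Order.min/+oo%E]_(i < N) tau i w.

(* The Laplace transform `'M_P X l` is +oo outside `Lambda`; `phi` and `psi`
   are meaningful on `Lambda` only. *)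
Section laplace.
Context (d : measure_display) (T : measurableType d) (R : realType).
Variables (P : probability T R) (X : T -> R).

Definition phi (l : R) : R := fine ('M_P X l).

Definition psi (l : R) : R := ln (phi l).

Definition Lambda : set R := [set l | ('M_P X l < +oo)%E].

Definition Lambda_plus : set R := [set l | 0 < l] `&` Lambda°.

(* The square root in the remainder presupposes that f is eventually
   nonnegative, whereas `Num.sqrt` is 0 on negative numbers, so this has to be
   required separately. *)
Definition L_class (l : R) : set (R -> R) :=
  [set f | (\forall x \near +oo_R, 0 <= f x) /\
     forall x : R, x = derive1 psi l * f x +o_(x \near +oo_R) Num.sqrt (f x)].

End laplace.

(* Main.v *)
Require Import Defs.
From mathcomp Require Import ring lra.

(** All probabilities involved decay exponentially in x, and only the rates
    matter.  Chernoff bounds summed over time give upper bounds with a free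
    parameter a.  Tilting by exp (l Z_n) and discarding the two exponentially
    negligible tails of the tilted walk gives
    P(tau(x) <= c) >= C exp (- r x) for every r > l - psi(l) / psi'(l), as soon
    as c >= x / v + 1 for some v slightly above psi'(l).

    If N psi'(l) < psi'(lstar), both B(x) / N and B(x) exceed x / u for some
    u < psi'(lstar).  A Chernoff bound with parameter slightly below lstar
    shows that hitting x after time x / u costs exponentially more than
    exp (- lstar x), so that P(tau <= B / N) and P(tau <= B) are equivalent,
    and 1 - (1 - p)^N ~ N p does the rest.

    If N psi'(l) > psi'(lstar), strict convexity of psi makes the Chernoff rate
    of {tau <= B / N}, with parameter l when l > lstar and slightly above lstar
    otherwise, strictly larger than the rate of {tau <= B}. *)

Local Open Scope ring_scope.
Local Open Scope classical_set_scope.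

(** * Integrals of products under independence *)

Section independence.
Import HBNNSimple.
Context (R : realType) (d : measure_display) (T : measurableType d).
Context (P : probability T R).

(** Independence of [G] and [V] enters through the integrals of [G] over events of [V], with [c] in
    the role of the mean of [G]. This settles indicators; simple functions and monotone convergence
    extend it to [f]. *)
Lemma ge0_integral_mul_comp_indep (G : T -> R) (V : {RV P >-> R}) (c : R)
    (f : R -> \bar R) :
    measurable_fun setT G -> (forall w, 0 <= G w) ->
    (forall B, measurable B ->
       \int[P]_(w in V @^-1` B) (G w)%:E = c%:E * P (V @^-1` B))%E ->
    measurable_fun setT f -> (forall x, 0 <= f x)%E ->
  (\int[P]_w (f (V w) * (G w)%:E) = c%:E * \int[P]_w f (V w))%E.
Proof.
move=> mG G0 GV mf f0; pose h := nnsfun_approx measurableT mf.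
have hV n : measurable_fun setT (fun w => (h n (V w))%:E).
  exact/measurable_EFinP/measurableT_comp.
have fE w : f (V w) = limn (fun n => (h n (V w))%:E).
  by apply/esym/cvg_lim => //; exact: cvg_nnsfun_approx.
transitivity (limn (fun n => \int[P]_w ((h n (V w))%:E * (G w)%:E)))%E.
  rewrite -monotone_convergence//=.
  - apply: eq_integral => w _; apply/esym/cvg_lim => //=.
    by apply: cvgeZr => //; exact: cvg_nnsfun_approx.
  - by move=> n; apply: emeasurable_funM => //; exact/measurable_EFinP.
  - by move=> n w _; rewrite mule_ge0// lee_fin.
  - move=> w _ a b ab; rewrite lee_wpmul2r ?lee_fin//.
    exact/lefP/nd_nnsfun_approx.
have -> : (\int[P]_w f (V w) = limn (fun n => \int[P]_w (h n (V w))%:E))%E.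
  rewrite -monotone_convergence//=.
  - by apply: eq_integral => w _; rewrite fE.
  - by move=> n w _; rewrite lee_fin.
  - by move=> w _ a b ab; rewrite lee_fin//; exact/lefP/nd_nnsfun_approx.
rewrite -limeMl//; last first.
  apply/ereal_nondecreasing_is_cvgn => a b ab; apply: ge0_le_integral => //.
  - by move=> w _; rewrite lee_fin.
  - by move=> w _; rewrite lee_fin; exact/lefP/nd_nnsfun_approx.
congr (limn _); apply/funext => n.
have mpre y : measurable (V @^-1` (h n @^-1` [set y])).
  by apply: measurable_funPTI; exact: measurable_sfunP.
(* Level-set decomposition of the simple function [h n]: each term is an indicator of an event of
   [V], to which [GV] applies. *)
have hE w : (h n (V w))%:E =
    (\sum_(y \in range (h n)) y%:E * (\1_(V @^-1` (h n @^-1` [set y])) w)%:E)%E.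
  by rewrite fimfunE -fsumEFin.
have y0 y w : (0 <= y%:E * (\1_(V @^-1` (h n @^-1` [set y])) w)%:E :> \bar R)%E.
  exact: (nnfun_muleindic_ge0 (h n) y (V w)).
have mI y : measurable_fun setT
    (fun w => y%:E * (\1_(V @^-1` (h n @^-1` [set y])) w)%:E : \bar R)%E.
  apply: emeasurable_funM => //; apply/measurable_EFinP.
  exact: measurable_indic.
transitivity (\int[P]_w \sum_(y \in range (h n))
    (y%:E * (\1_(V @^-1` (h n @^-1` [set y])) w)%:E * (G w)%:E))%E.
  apply: eq_integral => w _; rewrite hE muleC ge0_mule_fsumr//.
  by apply: eq_fsbigr => y _; rewrite muleC.
rewrite ge0_integral_fsum//; last 2 first.
  - by move=> y; apply: (emeasurable_funM (mI y)); exact/measurable_EFinP.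
  - by move=> y w _; rewrite mule_ge0// lee_fin.
under [in RHS]eq_integral do rewrite hE.
rewrite ge0_integral_fsum//.
rewrite ge0_mule_fsumr; last by move=> y; exact: integral_ge0.
apply: eq_fsbigr => y /set_mem [x _ <-{y}].
have hx0 : (0 <= (h n x)%:E)%E by rewrite lee_fin.
have m1 : measurable_fun setT
    (fun w => (\1_(V @^-1` (h n @^-1` [set h n x])) w)%:E : \bar R).
  by apply/measurable_EFinP; exact: measurable_indic.
rewrite [in RHS]ge0_integralZl//.
under eq_integral do rewrite -muleA.
rewrite ge0_integralZl//; last 2 first.
- by apply: (emeasurable_funM m1); exact/measurable_EFinP.
- by move=> w _; rewrite mule_ge0// lee_fin.
rewrite integral_indic// setIT muleCA -GV; last exact: measurable_sfunP.
congr (_ * _)%E; rewrite [RHS]integral_mkcond; apply: eq_integral => w _.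
rewrite patchE indicE; case: ifPn => _; by rewrite ?mul1e ?mul0e.
Qed.

End independence.

(** * Exponential moments of the walk *)

Section walk_mgf.
Context (R : realType) (d : measure_display) (T : measurableType d).
Context (P : probability T R) (X : {RV P >-> R}) (xi : nat -> {RV P >-> R}).

Let W := walk (fun n => xi n : T -> R).

Lemma measurable_walk n : measurable_fun setT (W n).
Proof. by apply: measurable_sum => i. Qed.

Lemma mmt_gen_funE (a : R) :
  'M_P X a = (\int[P]_w (expR (a * X w))%:E)%E.
Proof.
rewrite /mmt_gen_fun unlock; apply: eq_integral => w _ /=.
by rewrite mulrC.
Qed.

Lemma measurable_expRM (a : R) d' (T' : measurableType d') (f : T' -> R) :
  measurable_fun setT f -> measurable_fun setT (fun w => expR (a * f w)).
Proof.
by move=> mf; apply: measurableT_comp => //; exact: measurable_funM.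
Qed.

Lemma phiE (a : R) : Lambda P X a -> (phi P X a)%:E = 'M_P X a.
Proof.
move=> La; rewrite /phi fineK// ge0_fin_numE// mmt_gen_funE.
by apply: integral_ge0 => w _; rewrite lee_fin expR_ge0.
Qed.

Lemma phi_ge0 (a : R) : 0 <= phi P X a.
Proof.
apply: fine_ge0; rewrite mmt_gen_funE.
by apply: integral_ge0 => w _; rewrite lee_fin expR_ge0.
Qed.

Context (xi_indep : mutually_independent P (fun i => xi i : T -> R)).
Context (xi_law : forall i, same_law P (xi i) X).

Lemma mmt_gen_fun_same_law (a : R) i :
  (\int[P]_w (expR (a * xi i w))%:E)%E = 'M_P X a.
Proof.
pose f (x : R) := (expR (a * x))%:E.
have mf : measurable_fun setT f.
  by apply/measurable_EFinP; apply: measurable_expRM; exact: measurable_id.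
have f0 x : (0 <= f x)%E by rewrite lee_fin expR_ge0.
rewrite mmt_gen_funE -[LHS](ge0_integral_distribution (xi i) mf f0).
rewrite -[RHS](ge0_integral_distribution X mf f0).
by apply: eq_measure_integral => A mA _; exact: xi_law.
Qed.

(* Strengthened with an event on later steps so that the induction can move
   one step from the event into the walk. *)
Lemma integral_expR_walk_cap (a : R) (n : nat) (J : {fset nat})
    (A : nat -> set R) :
    Lambda P X a -> (forall i, i \in J -> (n <= i)%N) ->
    (forall i, measurable (A i)) ->
  let E := \bigcap_(i in [set` J]) (xi i @^-1` A i) in
  (\int[P]_(w in E) (expR (a * W n w))%:E = (phi P X a ^+ n)%:E * P E)%E.
Proof.
move=> La; elim: n J A => [|n IH] J A Jn mA E; have mE : measurable E.
- apply: fin_bigcap_measurable; first exact: finite_fset.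
  by move=> i _; exact: measurable_funPTI.
- under eq_integral do rewrite /W /walk big_ord0 mulr0 expR0.
  by rewrite integral_cst// expr0.
- apply: fin_bigcap_measurable; first exact: finite_fset.
  by move=> i _; exact: measurable_funPTI.
(* [G] collects the first [n] steps and the event on the steps in [J]; the remaining factor is a
   function of [xi n] alone. *)
pose G w := expR (a * W n w) * \1_E w.
have nJ : n \notin J by apply/negP => /Jn; rewrite ltnn.
have GV (B : set R) : measurable B ->
    (\int[P]_(w in xi n @^-1` B) (G w)%:E =
     (phi P X a ^+ n * fine (P E))%:E * P (xi n @^-1` B))%E.
  (* Every index in [J] exceeds [n], so slot [n] is free to carry [B], and the induction hypothesis
     applies to [J] enlarged by [n]. *)
  move=> mB; pose A' i := if i == n then B else A i.
  have mA' i : measurable (A' i) by rewrite /A'; case: ifP.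
  have EE : \bigcap_(i in [set` (n |` J)%fset]) (xi i @^-1` A' i) =
      (xi n @^-1` B) `&` E.
    apply/seteqP; split=> [w Ew|w [Bw Ew] i /=].
      split; first by have := Ew n; rewrite /= !inE eqxx /A' eqxx; exact.
      move=> i iJ; have := Ew i; rewrite /= !inE iJ orbT /A'.
      case: eqP => [ei|_]; last exact.
      by move: nJ; rewrite -ei iJ.
    rewrite !inE /A'; case: eqP => [-> //|_ /= iJ]; exact: Ew.
  have J'n i : i \in (n |` J)%fset -> (n <= i)%N.
    by rewrite !inE => /orP[/eqP->//|/Jn/ltnW].
  have := IH _ _ J'n mA'; rewrite /= EE => IH'.
  transitivity (\int[P]_(w in (xi n @^-1` B) `&` E) (expR (a * W n w))%:E)%E.
    rewrite integral_mkcondr; apply: eq_integral => w _.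
    rewrite patchE /G indicE; case: ifPn => _; by rewrite ?mulr1 ?mulr0.
  rewrite {}IH' -EE xi_indep// big_fsetU1//= {1}/A' eqxx EFinM -!muleA.
  congr (_ * _)%E; rewrite muleC; congr (_ * _)%E.
  rewrite fineK ?fin_num_measure// xi_indep//.
  apply: eq_big_seq => i iJ; rewrite /A'; case: eqP => // ei.
  by move: nJ; rewrite -ei iJ.
pose f (x : R) := (expR (a * x))%:E.
have mf : measurable_fun setT f.
  by apply/measurable_EFinP; apply: measurable_expRM; exact: measurable_id.
have mG : measurable_fun setT G.
  apply: measurable_funM; last exact: measurable_indic.
  by apply: measurable_expRM; exact: measurable_walk.
have G0 w : 0 <= G w by rewrite mulr_ge0 ?expR_ge0.
have := ge0_integral_mul_comp_indep mG G0 GV mf (fun x => expR_ge0 _).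
rewrite mmt_gen_fun_same_law -phiE// => intG.
have PE : P E = (fine (P E))%:E by rewrite fineK// fin_num_measure.
rewrite [in RHS]PE -EFinM exprSr mulrAC EFinM -intG.
rewrite integral_mkcond; apply: eq_integral => w _.
rewrite patchE /f /G indicE /W /walk big_ord_recr /=; case: ifPn => _.
  by rewrite mulr1 -EFinM -expRD -mulrDr addrC.
by rewrite mulr0 mule0.
Qed.

Lemma integral_expR_walk (a : R) n : Lambda P X a ->
  (\int[P]_w (expR (a * W n w))%:E = (phi P X a ^+ n)%:E)%E.
Proof.
move=> La.
have E0 : \bigcap_(i in [set` fset0]) (xi i @^-1` [set: R]) = [set: T].
  by apply/seteqP; split.
have := @integral_expR_walk_cap a n fset0 (fun=> setT) La.
by rewrite /= E0 probability_setT mule1 => ->.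
Qed.

End walk_mgf.

(** * Chernoff and tilting bounds for the walk *)

Section walk_bounds.
Context (R : realType) (d : measure_display) (T : measurableType d).
Context (P : probability T R) (X : {RV P >-> R}) (xi : nat -> {RV P >-> R}).
Context (xi_indep : mutually_independent P (fun i => xi i : T -> R)).
Context (xi_law : forall i, same_law P (xi i) X).

Let W := walk (fun n => xi n : T -> R).

Lemma measurable_walk_ge n x : measurable [set w | x <= W n w].
Proof.
rewrite (_ : [set _ | _] = W n @^-1` `[x, +oo[).
  by rewrite -[X in measurable X]setTI; exact: measurable_walk.
by apply/seteqP; split => w /=; rewrite in_itv/= andbT.
Qed.

(** Exponential Markov inequality with a union bound over times: on [A] one of the terms
    [expR (a * (W t w - x))] is at least 1, and each has mean
    [expR (- (a * x)) * phi P X a ^+ t]. *)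
Lemma chernoff_union (a x : R) (m n : nat) (A : set T) : 0 <= a ->
    Lambda P X a -> measurable A ->
    A `<=` [set w | exists2 t, (m <= t < n)%N & x <= W t w] ->
  fine (P A) <= expR (- (a * x)) * \sum_(m <= t < n) phi P X a ^+ t.
Proof.
move=> a0 La mA AW; rewrite -lee_fin fineK ?fin_num_measure//.
have mexp t : measurable_fun setT (fun w => expR (a * W t w)).
  by apply: measurable_expRM; exact: measurable_walk.
have mE t : measurable_fun setT
    (fun w => (expR (- (a * x)) * expR (a * W t w))%:E).
  by apply/measurable_EFinP; exact: measurable_funM.
have -> : P A = (\int[P]_w (\1_A w)%:E)%E by rewrite integral_indic// setIT.
apply: (@le_trans _ _ (\int[P]_w
    \sum_(m <= t < n) (expR (- (a * x)) * expR (a * W t w))%:E))%E.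
  apply: ge0_le_integral => //.
  - by apply/measurable_EFinP; exact: measurable_indic.
  - exact: emeasurable_sum.
  move=> w _; rewrite sumEFin lee_fin indicE.
  have [wA|_] := boolP (w \in A); last first.
    by apply: sumr_ge0 => t _; rewrite mulr_ge0 ?expR_ge0.
  have [t mtn xW] := AW _ (set_mem wA).
  rewrite (bigD1_seq t) ?mem_index_iota ?iota_uniq//=.
  rewrite -[leLHS]addr0 lerD//; last first.
    by apply: sumr_ge0 => i _; rewrite mulr_ge0 ?expR_ge0.
  by rewrite -expRD -expR0 ler_expR addrC subr_ge0 ler_wpM2l.
rewrite ge0_integral_sum//.
rewrite mulr_sumr -sumEFin; apply: lee_sum => t _.
under eq_integral do rewrite EFinM.
rewrite ge0_integralZl//; last exact/measurable_EFinP.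
by rewrite (integral_expR_walk xi_indep xi_law).
Qed.

(* On the event that [W n] lies outside [n v1, n v2], exponential tilting by
   [l + s] or [l - s] dominates the tilting by [l]. *)
Lemma tilted_lower_bound (l s v1 v2 : R) (n : nat) : 0 <= l -> 0 <= s ->
    Lambda P X l -> Lambda P X (l + s) -> Lambda P X (l - s) ->
  phi P X l ^+ n <=
  expR (l * v2) ^+ n * fine (P [set w | n%:R * v1 <= W n w]) +
  (expR (- (s * v2)) * phi P X (l + s)) ^+ n +
  (expR (s * v1) * phi P X (l - s)) ^+ n.
Proof.
move=> l0 s0 Ll Lls Lms; set A := [set w | _].
have mA : measurable A by exact: measurable_walk_ge.
have mexp a : measurable_fun setT (fun w => expR (a * W n w)).
  by apply: measurable_expRM; exact: measurable_walk.
rewrite -lee_fin -(integral_expR_walk xi_indep xi_law)//.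
have expn (y : R) : expR y ^+ n = expR (n%:R * y) by rewrite expRM_natl.
pose f1 w := (expR (l * v2) ^+ n * \1_A w)%:E.
pose f2 w := (expR (- (s * v2)) ^+ n * expR ((l + s) * W n w))%:E.
pose f3 w := (expR (s * v1) ^+ n * expR ((l - s) * W n w))%:E.
have m1 : measurable_fun setT f1.
  by apply/measurable_EFinP; apply: measurable_funM => //;
    exact: measurable_indic.
have m2 : measurable_fun setT f2.
  by apply/measurable_EFinP; exact: measurable_funM.
have m3 : measurable_fun setT f3.
  by apply/measurable_EFinP; exact: measurable_funM.
have f10 w : (0 <= f1 w)%E by rewrite lee_fin mulr_ge0// exprn_ge0 ?expR_ge0.
have f20 w : (0 <= f2 w)%E.
  by rewrite lee_fin mulr_ge0 ?exprn_ge0 ?expR_ge0.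
have f30 w : (0 <= f3 w)%E.
  by rewrite lee_fin mulr_ge0 ?exprn_ge0 ?expR_ge0.
apply: (@le_trans _ _ (\int[P]_w (f1 w + f2 w + f3 w)))%E.
  apply: ge0_le_integral => //.
  - exact/measurable_EFinP.
  - by apply: emeasurable_funD => //; exact: emeasurable_funD.
  move=> w _; rewrite -!EFinD lee_fin !expn -!expRD indicE.
  set e1 := expR _ * _; set e2 := expR (_ + (l + s) * _).
  set e3 := expR (_ + (l - s) * _).
  have e10 : 0 <= e1 by rewrite mulr_ge0 ?expR_ge0.
  have e20 : 0 <= e2 by exact: expR_ge0.
  have e30 : 0 <= e3 by exact: expR_ge0.
  (* Below n v1 the term [e3] dominates, above n v2 the term [e2]; in between the indicator is 1 and
     [e1] does. *)
  have [Wv1|Wv1] := leP (n%:R * v1) (W n w); last first.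
    suff: expR (l * W n w) <= e3 by lra.
    rewrite ler_expR; nra.
  have [Wv2|Wv2] := leP (n%:R * v2) (W n w).
    suff: expR (l * W n w) <= e2 by lra.
    rewrite ler_expR; nra.
  suff: expR (l * W n w) <= e1 by lra.
  rewrite /e1 mem_set// mulr1 ler_expR; nra.
rewrite ge0_integralD//; last exact: emeasurable_funD; last first.
  by move=> w _; exact: adde_ge0.
rewrite ge0_integralD//.
rewrite [in leRHS]exprMn [in leRHS]exprMn !EFinD !EFinM.
rewrite fineK ?fin_num_measure// leeD ?leeD//.
- rewrite /f1; under eq_integral do rewrite EFinM.
  rewrite ge0_integralZl//; last first.
    by apply/measurable_EFinP; exact: measurable_indic.
  by rewrite integral_indic// setIT.
- rewrite /f2; under eq_integral do rewrite EFinM.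
  rewrite ge0_integralZl//; last exact/measurable_EFinP.
  by rewrite (integral_expR_walk xi_indep xi_law).
- rewrite /f3; under eq_integral do rewrite EFinM.
  rewrite ge0_integralZl//; last exact/measurable_EFinP.
  by rewrite (integral_expR_walk xi_indep xi_law).
Qed.

End walk_bounds.

(** The difference quotient along [u] tends to [derive1 f x * u], hence is eventually below [c]. The
    direction [u] lets one statement serve both sides of [x]. *)
Lemma near_directional_lt (R : realType) (f : R -> R) (x u c : R) :
    derivable f x 1 -> derive1 f x * u < c ->
  \forall h \near 0^'+, f (x + h * u) < f x + h * c.
Proof.
move=> df fc.
have dfx : differentiable f x by exact/derivable1_diffP.
have Du : 'D_u f x = derive1 f x * u by rewrite deriveE// diff1E// mulrC.
have := @diff_derivable _ _ _ f x u dfx.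
rewrite /derivable -/(derive _ _ _) => /cvg_ex[/= L fL].
have EL : L = derive1 f x * u by rewrite -Du; apply/esym/cvg_lim.
move/cvg_dnbhs_at_right : fL; rewrite EL => /cvgr_lt /(_ _ fc) fc'.
near=> h.
have h0 : 0 < h by near: h; exact: nbhs_right_gt.
have : (f (h * u + x) - f x) / h < c by rewrite mulrC; near: h; exact: fc'.
by rewrite ltr_pdivrMr// [x + _]addrC; lra.
Unshelve. all: by end_near.
Qed.

(** * Strict convexity at the level of integrals *)

Section ae_positive.
Context (R : realType) (d : measure_display) (T : measurableType d).
Context (P : probability T R).

Lemma ge0_integral_eq0_ae (f : T -> R) : measurable_fun setT f ->
    (forall w, 0 <= f w) -> (\int[P]_w (f w)%:E = 0)%E ->
  {ae P, forall w, f w = 0}.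
Proof.
move=> mf f0 intf.
have /(ae_eq_integral_abs P measurableT) : measurable_fun setT (EFin \o f).
  exact/measurable_EFinP.
case=> + _; have -> : (\int[P]_w `|(EFin \o f) w| = 0)%E.
  by rewrite -[RHS]intf; apply: eq_integral => w _ /=; rewrite ger0_norm.
by move=> /(_ erefl); apply: filterS => w /= /(_ Logic.I) [].
Qed.

Lemma ae_false : ~ {ae P, forall w, False}.
Proof.
rewrite /almost_everywhere/= => -[A [mA PA]].
rewrite (_ : ~` _ = setT) => [TA|]; last by apply/seteqP; split => // w _ [].
have : A = setT by apply/seteqP; split.
by move=> AT; move: PA; rewrite AT probability_setT => -[] /eqP;
  rewrite oner_eq0.
Qed.

(* The strict inequality 1 + y < exp y at y = p - r and y = q - r, where
   r = t p + (1 - t) q. *)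
Lemma integral_expR_convex_lt1 (p q : T -> R) (t : R) :
    measurable_fun setT p -> measurable_fun setT q ->
    (\int[P]_w (expR (p w))%:E = 1)%E -> (\int[P]_w (expR (q w))%:E = 1)%E ->
    0 < t < 1 -> ~ {ae P, forall w, p w = q w} ->
  (\int[P]_w (expR (t * p w + (1 - t) * q w))%:E < 1)%E.
Proof.
move=> mp mq intp intq /andP[t0 t1] pq.
have mexp (f : T -> R) :
    measurable_fun setT f -> measurable_fun setT (fun w => expR (f w)).
  by move=> mf; exact: measurableT_comp.
have mZ (u : R) (f : T -> R) :
    measurable_fun setT f -> measurable_fun setT (fun w => u * f w).
  by move=> mf; exact: measurable_funM.
have mD3 (u v : R) (f g h : T -> R) : measurable_fun setT f ->
    measurable_fun setT g -> measurable_fun setT h ->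
    measurable_fun setT (fun w => u * f w + v * g w - h w).
  move=> mf mg mh; apply: measurable_funB => //.
  by apply: measurable_funD; exact: mZ.
pose r w := t * p w + (1 - t) * q w.
have mr : measurable_fun setT r by apply: measurable_funD; exact: mZ.
pose D w := t * expR (p w) + (1 - t) * expR (q w) - expR (r w).
(* The linear terms cancel because t (p - r) + (1 - t) (q - r) = 0, so [D] is a positive combination
   of gaps in 1 + y <= exp y. *)
have DE w : D w = expR (r w) * (t * (expR (p w - r w) - (1 + (p w - r w))) +
    (1 - t) * (expR (q w - r w) - (1 + (q w - r w)))).
  have pE : expR (p w) = expR (r w) * expR (p w - r w).
    by rewrite -expRD addrC subrK.
  have qE : expR (q w) = expR (r w) * expR (q w - r w).
    by rewrite -expRD addrC subrK.
  rewrite /D pE qE; move: (expR (p w - _)) (expR (q w - _)) (expR (r w)).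
  by move=> u v s; rewrite /r; ring.
have D0 w : 0 <= D w.
  rewrite DE mulr_ge0 ?expR_ge0// addr_ge0// mulr_ge0 ?subr_ge0 ?expR_ge1Dx//.
  - exact: ltW.
  - exact: ltW.
have D_eq0 w : D w = 0 -> p w = q w.
  apply: contra_eq => pqw; rewrite DE mulf_neq0//.
    by rewrite gt_eqF ?expR_gt0.
  rewrite gt_eqF// ltr_wpDr//.
    by rewrite mulr_ge0 ?subr_ge0 ?expR_ge1Dx// ltW.
  rewrite mulr_gt0// subr_gt0 expR_gt1Dx// /r.
  have -> : p w - (t * p w + (1 - t) * q w) = (1 - t) * (p w - q w) by ring.
  by rewrite mulf_neq0 ?subr_eq0// gt_eqF ?subr_gt0.
have mD : measurable_fun setT D by apply: mD3; exact: mexp.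
have intDr : (\int[P]_w (D w)%:E + \int[P]_w (expR (r w))%:E = 1)%E.
  rewrite -ge0_integralD//; [|by move=> w _; rewrite lee_fin
    |exact/measurable_EFinP|exact/measurable_EFinP/mexp].
  transitivity (\int[P]_w
      (t%:E * (expR (p w))%:E + (1 - t)%:E * (expR (q w))%:E))%E.
    by apply: eq_integral => w _; rewrite -!EFinM -!EFinD /D subrK.
  have h0 u w : 0 <= u -> (0 <= u%:E * (expR w)%:E :> \bar R)%E.
    by move=> u0; rewrite mule_ge0 ?lee_fin ?expR_ge0.
  have hm (u : R) (f : T -> R) : measurable_fun setT f ->
      measurable_fun setT (fun w : T => u%:E * (expR (f w))%:E : \bar R)%E.
    by move=> mf; apply/measurable_EFinP; apply: mZ; exact: mexp.
  have u0 := ltW t0; have v0 : 0 <= 1 - t by rewrite subr_ge0 ltW.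
  rewrite ge0_integralD//; [|by move=> w _; exact: h0|exact: hm
    |by move=> w _; exact: h0|exact: hm].
  rewrite !ge0_integralZl//; last 2 first.
  - exact/measurable_EFinP/mexp.
  - exact/measurable_EFinP/mexp.
  by rewrite intp intq !mule1 -EFinD addrC subrK.
have intD0 : (0 <= \int[P]_w (D w)%:E)%E.
  by apply: integral_ge0 => w _; rewrite lee_fin.
have intr0 : (0 <= \int[P]_w (expR (r w))%:E)%E by exact: integral_ge0.
(* Finiteness is what makes the inequality strict when the positive integral of [D] is added to this
   one. *)
have intr_fin : (\int[P]_w (expR (r w))%:E)%E \is a fin_num.
  rewrite ge0_fin_numE// (@le_lt_trans _ _ 1%E) ?ltry//.
  by rewrite -intDr leeDr.
rewrite -/(r _) -intDr lteDr// lt_def intD0 andbT.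
apply/eqP => D_0; apply: pq.
by have := ge0_integral_eq0_ae mD D0 D_0; apply: filterS => w /D_eq0.
Qed.

End ae_positive.

(** * The log-Laplace transform and its strict convexity *)

Section log_laplace.
Context (R : realType) (d : measure_display) (T : measurableType d).
Context (P : probability T R) (X : {RV P >-> R}).

Let mexp a b : measurable_fun setT (fun w => expR (a * X w + b)).
Proof.
apply: measurableT_comp => //; apply: measurable_funD => //.
exact: measurable_funM.
Qed.

Lemma phi_gt0 a : Lambda P X a -> 0 < phi P X a.
Proof.
move=> La; rewrite lt_def phi_ge0 andbT; apply/eqP => phi0.
apply: (@ae_false _ _ _ P).
have : {ae P, forall w, expR (a * X w + 0) = 0}.
  apply: ge0_integral_eq0_ae => //.
  transitivity ('M_P X a); last by rewrite -phiE// phi0.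
  rewrite mmt_gen_funE.
  by apply: eq_integral => w _; rewrite addr0.
by apply: filterS => w /eqP; rewrite gt_eqF ?expR_gt0.
Qed.

Lemma expR_psi a : Lambda P X a -> expR (psi P X a) = phi P X a.
Proof. by move=> La; rewrite lnK// posrE; exact: phi_gt0. Qed.

Lemma phi_lt1 a : Lambda P X a -> (phi P X a < 1) = (psi P X a < 0).
Proof. by move=> La; rewrite -(expR_psi La) expR_lt1. Qed.

Lemma phi_gt1 a : Lambda P X a -> (1 < phi P X a) = (0 < psi P X a).
Proof. by move=> La; rewrite -(expR_psi La) expR_gt1. Qed.

Lemma integral_expR_affine a b :
  (\int[P]_w (expR (a * X w + b))%:E = (expR b)%:E * 'M_P X a)%E.
Proof.
rewrite mmt_gen_funE -ge0_integralZl//.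
- by apply: eq_integral => w _; rewrite expRD EFinM muleC.
- by apply/measurable_EFinP; exact: measurable_expRM.
Qed.

Lemma integral_expR_normalized a : Lambda P X a ->
  (\int[P]_w (expR (a * X w + - psi P X a))%:E = 1)%E.
Proof.
move=> La; rewrite integral_expR_affine -phiE// -EFinM expRN expR_psi//.
by rewrite mulVf// gt_eqF// phi_gt0.
Qed.

Lemma mmt_gen_fun0 : 'M_P X 0 = 1%E.
Proof.
rewrite /mmt_gen_fun (_ : expR \o _ = cst 1) ?expectation_cst//.
by apply/funext => w /=; rewrite mulr0 expR0.
Qed.

Lemma Lambda0 : Lambda P X 0.
Proof. by rewrite /Lambda/= mmt_gen_fun0 ltry. Qed.

Lemma psi0 : psi P X 0 = 0.
Proof. by rewrite /psi /phi mmt_gen_fun0 ln1. Qed.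

Context (X_nonconst : ~ exists c : R, {ae P, forall w, X w = c}).

(** The variables a X - psi(a) and b X - psi(b) have exponential mean 1. If they agreed almost
    everywhere, X would be almost everywhere constant, so their convex combination has exponential
    mean below 1. *)
Lemma psi_strict_convex (a b t : R) : Lambda P X a -> Lambda P X b ->
    a != b -> 0 < t < 1 ->
  Lambda P X (t * a + (1 - t) * b) /\
  psi P X (t * a + (1 - t) * b) < t * psi P X a + (1 - t) * psi P X b.
Proof.
move=> La Lb ab t01.
set c := t * a + _; set e := t * psi P X a + _.
have maff u v : measurable_fun setT (fun w => u * X w + v).
  by apply: measurable_funD => //; exact: measurable_funM.
have pq : ~ {ae P, forall w, a * X w + - psi P X a = b * X w + - psi P X b}.
  move=> pq; apply: X_nonconst; exists ((psi P X a - psi P X b) / (a - b)).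
  move: pq; apply: filterS => w pqw.
  have ab' : a - b != 0 by rewrite subr_eq0.
  apply: (mulIf ab'); rewrite divfK//.
  by move: pqw; move: (psi P X a) (psi P X b) => u v; lra.
have := integral_expR_convex_lt1 (maff _ _) (maff _ _)
  (integral_expR_normalized La) (integral_expR_normalized Lb) t01 pq.
rewrite (_ : integral _ _ _ = (expR (- e))%:E * 'M_P X c)%E; last first.
  rewrite -integral_expR_affine; apply: eq_integral => w _.
  by rewrite /c /e; congr (expR _)%:E; ring.
move=> lt1.
(* An infinite ['M_P X c] would contradict the bound by 1, so the inequality itself places [c] in
   [Lambda]. *)
have Lc : Lambda P X c.
  rewrite /Lambda/= ltey; apply/eqP => Mc; move: lt1.
  by rewrite Mc gt0_muley ?lte_fin ?expR_gt0.
split => //.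
move: lt1; rewrite -phiE// -EFinM lte_fin expRN -expR_psi//.
by rewrite mulrC ltr_pdivrMr ?expR_gt0// mul1r ltr_expR.
Qed.

End log_laplace.

Lemma near_at_right_shift (R : realType) (Q : set R) (x u : R) :
  (\forall y \near x, Q y) -> \forall h \near 0^'+, Q (x + h * u).
Proof.
have : (fun h : R => x + h * u) h @[h --> 0] --> x.
  rewrite -[X in _ --> X]addr0 -{2}[0](mul0r u).
  by apply: cvgD; [exact: cvg_cst|apply: cvgMl; exact: cvg_id].
by move=> /cvg_at_right_filter xQ /xQ.
Qed.

(** * Derivative of psi and tangent inequalities *)

Section psi_derivative.
Context (R : realType) (d : measure_display) (T : measurableType d).
Context (P : probability T R) (X : {RV P >-> R}).
Context (X_nonconst : ~ exists c : R, {ae P, forall w, X w = c}).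
Context (phi_diff2 : forall l, Lambda_plus P X l ->
  derivable (phi P X) l 1 /\ derivable (derive1 (phi P X)) l 1).

Lemma Lambda_plus_gt0 l : Lambda_plus P X l -> 0 < l.
Proof. by case. Qed.

Lemma Lambda_plus_sub l : Lambda_plus P X l -> Lambda P X l.
Proof. by case=> _ /interior_subset. Qed.

Lemma open_Lambda_plus : open (Lambda_plus P X).
Proof.
by apply: openI; [exact: open_gt|exact: open_interior].
Qed.

Lemma near_Lambda_plus l u : Lambda_plus P X l ->
  \forall h \near 0^'+, Lambda_plus P X (l + h * u).
Proof.
move=> Ll; apply: near_at_right_shift.
exact: (open_nbhs_nbhs (conj open_Lambda_plus Ll)).
Qed.

Lemma derivable_psi l : Lambda_plus P X l -> derivable (psi P X) l 1.
Proof.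
move=> Ll; have p0 := phi_gt0 (Lambda_plus_sub Ll).
have [dphi _] := phi_diff2 Ll.
have dln := is_derive1_ln p0.
have /derivableP dp := dphi.
by have [] := is_derive1_comp dln dp.
Qed.

Lemma derive1_psi l : Lambda_plus P X l ->
  derive1 (psi P X) l = (phi P X l)^-1 * derive1 (phi P X) l.
Proof.
move=> Ll; have p0 := phi_gt0 (Lambda_plus_sub Ll).
have [dphi _] := phi_diff2 Ll.
have dln := is_derive1_ln p0.
have /derivableP dp := dphi.
by have [_] := is_derive1_comp dln dp; rewrite !derive1E.
Qed.

(** The formula psi' = phi' / phi holds on a whole neighbourhood since [Lambda_plus] is open, and
    phi' is continuous at [l], being differentiable there. *)
Lemma continuous_derive1_psi l : Lambda_plus P X l ->
  {for l, continuous (derive1 (psi P X))}.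
Proof.
move=> Ll; have p0 := phi_gt0 (Lambda_plus_sub Ll).
have [/derivable1_diffP/differentiable_continuous cphi
  /derivable1_diffP/differentiable_continuous cphi'] := phi_diff2 Ll.
suff : derive1 (psi P X) x @[x --> l] --> derive1 (psi P X) l by [].
rewrite [X in _ --> X]derive1_psi//.
have : (phi P X x)^-1 * derive1 (phi P X) x @[x --> l] -->
    (phi P X l)^-1 * derive1 (phi P X) l.
  by apply: cvgM => //; apply: cvgV => //; rewrite gt_eqF.
apply: cvg_trans; apply: near_eq_cvg.
near=> x; rewrite derive1_psi//.
by near: x; exact: (open_nbhs_nbhs (conj open_Lambda_plus Ll)).
Unshelve. all: by end_near.
Qed.

(** If the chord from [l] to [m] stayed below the tangent, psi would exceed the chord right next to
    [l], against convexity. [m] ranges over [Lambda] so that the point 0 is covered. *)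
Lemma psi_slope_le l m : Lambda_plus P X l -> Lambda P X m ->
  derive1 (psi P X) l * (m - l) <= psi P X m - psi P X l.
Proof.
move=> Ll Lm; have [->|lm] := eqVneq m l; first by rewrite !subrr mulr0.
rewrite leNgt; apply/negP => slope.
pose c := psi P X m - psi P X l.
have := near_directional_lt (f := fun x => - psi P X x) (x := l) (u := m - l)
   (c := - c).
have dN : derivable (fun x => - psi P X x) l 1.
  by apply: derivableN; exact: derivable_psi.
have -> : derive1 (fun x => - psi P X x) l = - derive1 (psi P X) l.
  by rewrite !derive1E; apply: deriveN; exact: derivable_psi.
rewrite mulNr ltrN2 => /(_ dN slope) H.
have [h [h0 h1]] : exists h : R, 0 < h < 1 /\
    - psi P X (l + h * (m - l)) < - psi P X l + h * - c.
  near (0 : R)^'+ => h; exists h; split.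
    by apply/andP; split; near: h; [exact: nbhs_right_gt|exact: nbhs_right_lt].
  by near: h.
have [_] := psi_strict_convex X_nonconst Lm (Lambda_plus_sub Ll) lm h0.
have -> : h * m + (1 - h) * l = l + h * (m - l) by ring.
move: h1; rewrite /c; move: (psi P X _) (psi P X m) (psi P X l) => u v w.
by lra.
Unshelve. all: by end_near.
Qed.

(** Strictness comes from the midpoint: the weak tangent inequality there, combined with strict
    convexity between [l] and [m]. *)
Lemma psi_tangent_lt l m : Lambda_plus P X l -> Lambda P X m -> m != l ->
  psi P X l + derive1 (psi P X) l * (m - l) < psi P X m.
Proof.
move=> Ll Lm ml.
have t01 : 0 < (2^-1 : R) < 1 by apply/andP; split; lra.
have [Lc] := psi_strict_convex X_nonconst Lm (Lambda_plus_sub Ll) ml t01.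
have := psi_slope_le Ll Lc.
move: (psi P X _) (psi P X m) (psi P X l) (derive1 _ l) => u v w p.
by lra.
Qed.

Lemma derive1_psi_lt l m : Lambda_plus P X l -> Lambda_plus P X m -> l < m ->
  derive1 (psi P X) l < derive1 (psi P X) m.
Proof.
move=> Ll Lm lm.
have := psi_tangent_lt Ll (Lambda_plus_sub Lm); rewrite gt_eqF// => /(_ isT).
have := psi_tangent_lt Lm (Lambda_plus_sub Ll); rewrite lt_eqF// => /(_ isT).
move: (psi P X _) (psi P X l) (derive1 _ l) (derive1 _ m) => u v p q h1 h2.
have : p * (m - l) < q * (m - l) by lra.
by rewrite ltr_pM2r// subr_gt0.
Qed.

(** At the origin the tangent at [l] lies strictly below psi(0) = 0. *)
Lemma derive1_psi_zero_gt0 l : Lambda_plus P X l -> psi P X l = 0 ->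
  0 < derive1 (psi P X) l.
Proof.
move=> Ll l0; have l_gt0 := Lambda_plus_gt0 Ll.
have := psi_tangent_lt Ll (Lambda0 X); rewrite lt_eqF// => /(_ isT).
by rewrite psi0 l0 add0r sub0r mulrN oppr_lt0 pmulr_lgt0.
Qed.

End psi_derivative.

(** The infimum runs over integers: if no time up to [c] works, every hitting time is at least the
    integer part of [c] plus 1, which exceeds [c]. *)
Lemma hitting_time_leP (T : Type) (R : realType) (Z : nat -> T -> R) (x c : R)
    (w : T) :
  (hitting_time Z x w <= c%:E)%E <-> exists2 t : nat, t%:R <= c & x <= Z t w.
Proof.
split=> [|[t tc xZ]]; last first.
  by apply: ge_ereal_inf; exists (t%:R)%:E; [exists t|rewrite lee_fin].
move=> tau_c; apply: contrapT => noZ; move: tau_c; apply/negP; rewrite -ltNge.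
(* [Num.truncn] is 0 on negative numbers and does not lie below [c] there; in that case
   nonnegativity of the infimum suffices. *)
have [c0|c0] := ltP c 0.
  apply: (@lt_le_trans _ _ 0%E); first by rewrite lte_fin.
  by apply: le_ereal_inf_tmp => _ [t _ <-]; rewrite lee_fin.
apply: (@lt_le_trans _ _ ((Num.truncn c).+1%:R)%:E).
  by rewrite lte_fin truncnS_gt.
apply: le_ereal_inf_tmp => _ [t /= xZ <-]; rewrite lee_fin ler_nat ltnNge.
apply/negP => tc; apply: noZ; exists t => //.
by rewrite (@le_trans _ _ (Num.truncn c)%:R) ?truncn_le ?ler_nat.
Qed.

(** In use, [p1] and [psi1] are the slope and the value of psi at [l]. The last inequality is strict
    at v = v2 = p1, hence survives a small shift of both speeds. *)
Lemma rate_margin (R : realFieldType) (l p0 p1 psi1 r : R) :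
    0 < l -> p0 < p1 -> 0 < r * p1 - l * p1 + psi1 ->
  exists v v2, [/\ p0 < v, v < p1, p1 < v2 & l * v2 - psi1 <= r * v].
Proof.
(* Shifting both speeds by [eta] costs at most eta (l + |r|) <= eta K, and [eta] spends at most half
   of the slack. *)
move=> l0 p01 g0; pose K := l + `|r| + 1.
have r0 := normr_ge0 r.
have K0 : 0 < K by rewrite /K; lra.
pose eta := Num.min ((r * p1 - l * p1 + psi1) / (2 * K)) ((p1 - p0) / 2).
have eta0 : 0 < eta by rewrite lt_min !divr_gt0 ?subr_gt0//; lra.
have etaK : eta * K < r * p1 - l * p1 + psi1.
  have : eta <= (r * p1 - l * p1 + psi1) / (2 * K) by rewrite ge_min lexx.
  by rewrite ler_pdivlMr; nra.
have etap : eta < p1 - p0.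
  have : eta <= (p1 - p0) / 2 by rewrite ge_min lexx orbT.
  by lra.
exists (p1 - eta), (p1 + eta); split; [lra|lra|lra|].
have : eta * r <= eta * `|r| by rewrite ler_pM2l// ler_norm.
by move: etaK; rewrite /K; nra.
Qed.

(** [kappa] may have either sign; rounding the time x / v up to [y] costs at most |kappa|. *)
Lemma exponent_le (R : realFieldType) (x v y kappa r : R) : 0 <= x -> 0 < v ->
    kappa <= r * v -> x / v <= y -> y <= x / v + 1 ->
  y * kappa <= `|kappa| + r * x.
Proof.
move=> x0 v0 kv xy yx.
have : kappa * (x / v) <= r * x.
  by rewrite mulrA ler_pdivrMr// [leRHS]mulrAC ler_wpM2r.
have := ler_norm kappa; have := normr_ge0 kappa.
by move: xy yx; move: (x / v) => u; nra.
Qed.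

(** * Lower bound on the hitting probability *)

Section hitting_lower_bound.
Context (R : realType) (d : measure_display) (T : measurableType d).
Context (P : probability T R) (X : {RV P >-> R}) (xi : nat -> {RV P >-> R}).
Context (xi_indep : mutually_independent P (fun i => xi i : T -> R)).
Context (xi_law : forall i, same_law P (xi i) X).

Let W := walk (fun n => xi n : T -> R).

Lemma measurable_hitting_time_le x c :
  measurable [set w | (hitting_time W x w <= c%:E)%E].
Proof.
rewrite (_ : [set _ | _] =
    \bigcup_(t in [set t : nat | t%:R <= c]) [set w | x <= W t w]).
  by apply: bigcup_measurable => t _; exact: measurable_walk_ge.
by apply/seteqP; split=> w /=;
  [move=> /hitting_time_leP[t]; exists t|
   move=> [t ? ?]; apply/hitting_time_leP; exists t].
Qed.

Definition hit_prob x c : R :=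
  fine (P [set w | (hitting_time W x w <= c%:E)%E]).

Context (X_nonconst : ~ exists c : R, {ae P, forall w, X w = c}).
Context (phi_diff2 : forall l, Lambda_plus P X l ->
  derivable (phi P X) l 1 /\ derivable (derive1 (phi P X)) l 1).

(** Under the tilt by [l] the walk has drift psi'(l), strictly between [v1] and [v2]. For a small
    extra tilt [s] each tail eventually carries at most a quarter of the tilted mass, so at least
    half of it stays on the event. *)
Lemma walk_ge_lower_bound (l v1 v2 : R) : Lambda_plus P X l ->
    v1 < derive1 (psi P X) l -> derive1 (psi P X) l < v2 ->
  \forall n \near \oo, 2^-1 * expR (- (n%:R * (l * v2 - psi P X l))) <=
    fine (P [set w | n%:R * v1 <= W n w]).
Proof.
move=> Ll v1l v2l.
have dpsi := derivable_psi phi_diff2 Ll.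
have [s [s0 Lls Lms p2 p1]] : exists s : R, [/\ 0 < s,
    Lambda_plus P X (l + s), Lambda_plus P X (l - s),
    psi P X (l + s) < psi P X l + s * v2 &
    psi P X (l - s) < psi P X l - s * v1].
  have v2l' : derive1 (psi P X) l * 1 < v2 by rewrite mulr1.
  have v1l' : derive1 (psi P X) l * -1 < - v1 by rewrite mulrN1 ltrN2.
  have N2 := near_directional_lt dpsi v2l'.
  have N1 := near_directional_lt dpsi v1l'.
  have NL2 := near_Lambda_plus 1 Ll.
  have NL1 := near_Lambda_plus (-1) Ll.
  near (0 : R)^'+ => s; exists s; split.
  - by near: s; exact: nbhs_right_gt.
  - by rewrite -[s]mulr1; near: s.
  - by rewrite -[s]mulr1 -mulrN; near: s.
  - by rewrite -{1}[s]mulr1; near: s.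
  - by rewrite -mulrN -{1}[s]mulr1 -[in l - _]mulrN; near: s.
(* Per-step ratios of the two tail bounds to [phi P X l]; by the choice of [s] their exponents are
   negative. *)
pose r2 := expR (psi P X (l + s) - psi P X l - s * v2).
pose r1 := expR (psi P X (l - s) - psi P X l + s * v1).
have small (u : R) : u < 0 -> \forall n \near \oo, expR u ^+ n < 4^-1.
  move=> u0; have : (expR u) ^+ n @[n --> \oo] --> (0 : R).
    by apply: cvg_expr; rewrite ger0_norm ?expR_ge0// expR_lt1.
  by move=> /cvgr_lt; apply; lra.
have N2 : \forall n \near \oo, r2 ^+ n < 4^-1.
  by apply: small; move: p2; move: (psi P X _) (psi P X l) => u v; lra.
have N1 : \forall n \near \oo, r1 ^+ n < 4^-1.
  by apply: small; move: p1; move: (psi P X _) (psi P X l) => u v; lra.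
near=> n.
have := tilted_lower_bound xi_indep xi_law v1 v2 n (ltW (Lambda_plus_gt0 Ll))
  (ltW s0) (Lambda_plus_sub Ll) (Lambda_plus_sub Lls) (Lambda_plus_sub Lms).
rewrite -/W; set p := fine _.
have -> : expR (- (s * v2)) * phi P X (l + s) = phi P X l * r2.
  rewrite -!expR_psi; [|exact: Lambda_plus_sub..].
  rewrite /r2 -!expRD; congr expR.
  by move: (psi P X _) (psi P X l) => u v; ring.
have -> : expR (s * v1) * phi P X (l - s) = phi P X l * r1.
  rewrite -!expR_psi; [|exact: Lambda_plus_sub..].
  rewrite /r1 -!expRD; congr expR.
  by move: (psi P X _) (psi P X l) => u v; ring.
have : r2 ^+ n < 4^-1 by near: n.
have : r1 ^+ n < 4^-1 by near: n.
rewrite !exprMn -!expR_psi; last exact: Lambda_plus_sub.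
rewrite -!expRM_natl; move: (r1 ^+ n) (r2 ^+ n) => u1 u2 h1 h2 H.
have -> : - (n%:R * (l * v2 - psi P X l)) =
    n%:R * psi P X l - n%:R * (l * v2) by ring.
rewrite expRD expRN [leLHS]mulrA ler_pdivrMr ?expR_gt0//.
have := expR_gt0 (n%:R * psi P X l).
move: H; move: (expR (n%:R * psi P X l)) (expR (n%:R * (l * v2))).
move=> ea eb H ea0.
by nra.
Unshelve. all: by end_near.
Qed.

(** The condition on the rate is open in the tilt, so [l0] can be replaced by a slightly larger
    [l1]. As psi'(l1) > psi'(l0), a speed [v] fits strictly between them, and it suffices that the
    walk is above [x] at the integer time just after x / v. *)
Lemma hit_prob_lower_bound (l0 r : R) : Lambda_plus P X l0 ->
    l0 * derive1 (psi P X) l0 - psi P X l0 < r * derive1 (psi P X) l0 ->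
    0 < derive1 (psi P X) l0 ->
  exists2 v, derive1 (psi P X) l0 < v & exists2 C, 0 < C &
    \forall x \near +oo, forall c, x / v + 1 <= c ->
      C * expR (- (r * x)) <= hit_prob x c.
Proof.
move=> Ll0 r0 v0; set psi' := derive1 (psi P X).
pose g l := r * psi' l - l * psi' l + psi P X l.
have cg : g l @[l --> l0] --> g l0.
  have c' := continuous_derive1_psi phi_diff2 Ll0.
  apply: cvgD; last first.
    apply: differentiable_continuous; apply/derivable1_diffP.
    exact: derivable_psi.
  by apply: cvgB; apply: cvgM => //; exact: cvg_cst.
have g0 : 0 < g l0 by rewrite /g; move: r0; rewrite -/psi'; lra.
have Ng := cvgr_gt _ cg _ g0.
have [l1 [l01 Ll1 g1]] : exists l1, [/\ l0 < l1, Lambda_plus P X l1 & 0 < g l1].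
  have NL := near_Lambda_plus 1 Ll0.
  have {}Ng := near_at_right_shift 1 (Ng _).
  near (0 : R)^'+ => h; exists (l0 + h * 1); split.
  - by rewrite mulr1 ltrDl; near: h; exact: nbhs_right_gt.
  - by near: h.
  - by near: h; exact: Ng.
have v01 : psi' l0 < psi' l1 by exact: derive1_psi_lt.
have l1_gt0 := Lambda_plus_gt0 Ll1.
have [v [v2 [v0v vv1 v1v2 kv]]] := rate_margin l1_gt0 v01 g1.
have vgt0 : 0 < v by exact: lt_trans v0 v0v.
exists v => //; move: (psi P X l1) kv (walk_ge_lower_bound Ll1 vv1 v1v2).
move=> psi1; set kappa := _ - psi1 => kv [n0 _ H].
(* The 1/2 comes from the bound for the walk; the exponential pays for rounding x / v up to an
   integer. *)
exists (2^-1 * expR (- `|kappa|)).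
  by rewrite mulr_gt0 ?expR_gt0// invr_gt0.
near=> x => c xc.
have x0 : 0 < x by near: x; exact: nbhs_pinfty_gt.
have n0x : n0%:R * v <= x.
  by near: x; apply: nbhs_pinfty_ge; exact: num_real.
have xv0 : 0 <= x / v by rewrite divr_ge0 // ltW.
(* The least integer strictly above x / v: it gives n v > x, while n <= x / v + 1 <= c. *)
pose n := (Num.truncn (x / v)).+1.
have n0n : (n0 <= n)%N.
  by apply: ltnW; rewrite ltnS truncn_ge_nat// ler_pdivlMr.
have nx : n%:R <= x / v + 1 by rewrite -natr1 lerD2r truncn_le.
have xn : x / v < n%:R by exact: truncnS_gt.
apply: (@le_trans _ _ (2^-1 * expR (- (n%:R * kappa)))).
  rewrite -mulrA -expRD ler_pM2l ?invr_gt0// ler_expR.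
  rewrite -opprD lerN2; apply: (exponent_le (v := v)) => //; exact: ltW.
apply: (le_trans (H n n0n)); apply: fine_le.
- apply: fin_num_measure; exact: measurable_walk_ge.
- apply: fin_num_measure; exact: measurable_hitting_time_le.
- apply: le_measure; rewrite ?inE.
  + exact: measurable_walk_ge.
  + exact: measurable_hitting_time_le.
  move=> w /= nvW; apply/hitting_time_leP; exists n.
    exact: le_trans nx xc.
  by rewrite (le_trans _ nvW)// -ler_pdivrMr// ltW.
Unshelve. all: by end_near.
Qed.

End hitting_lower_bound.

(** The maximum with 0 accommodates slopes [v] that may be negative. *)
Lemma exists_between_max (R : realFieldType) (v w : R) : v < w -> 0 < w ->
  exists u, [/\ 0 < u, v < u & u < w].
Proof.
move=> vw w0; exists ((Num.max 0 v + w) / 2).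
have m0 : 0 <= Num.max 0 v by rewrite le_max lexx.
have mv : v <= Num.max 0 v by rewrite le_max lexx orbT.
have mw : Num.max 0 v < w by rewrite gt_max w0 vw.
by move: m0 mv mw; move: (Num.max _ _) => m *; split; lra.
Qed.

(* l0 tilts the lower bound on the denominator, a is the Chernoff parameter of
   the numerator, r separates the two exponential rates, and b leaves room for
   the error term in x = psi'(l) B(x) + o(sqrt (B(x))). *)
Lemma fast_rates (R : realFieldType) (Lp : set R) (psi psi' : R -> R)
    (ls l k : R) :
    (forall x y, Lp x -> Lp y -> y != x -> psi x + psi' x * (y - x) < psi y) ->
    (forall c, psi' ls < c -> exists del, [/\ 0 < del, Lp (ls + del) &
       psi (ls + del) < psi ls + del * c]) ->
    Lp ls -> Lp l -> psi ls = 0 -> 0 < psi' ls -> 1 < k ->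
    psi' ls < k * psi' l ->
  exists l0 a r b, [/\ Lp l0, Lp a & psi' l <= psi' l0] /\
    [/\ 0 < psi a, l0 * psi' l0 - psi l0 < r * psi' l0, 0 < b, b < psi' l &
        r < a - psi a / (k * b)].
Proof.
move=> tangent right Lls Ll psi_ls vs0 k1 kv.
have k0 : 0 < k by rewrite (lt_trans ltr01).
have v0 : 0 < psi' l by rewrite -(pmulr_rgt0 _ k0) (lt_trans vs0).
have kv0 : 0 < k * psi' l by rewrite mulr_gt0.
have [l0 [a [rho [Ll0 La ll0 [psia rhoE rhoa]]]]] : exists l0 a rho,
    [/\ Lp l0, Lp a, psi' l <= psi' l0 &
    [/\ 0 < psi a, l0 * psi' l0 - psi l0 = rho * psi' l0 &
       rho < a - psi a / (k * psi' l)]].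
  (* If l <= ls, the denominator is tilted at [ls], where psi vanishes, and has rate ls; a = ls +
     del beats it by the first-order expansion. If l > ls, both parameters are [l] and k > 1 creates
     the gap. *)
  have [|lsl] := leP l ls.
    have [del [del0 La psia]] := right _ kv.
    move: psia; rewrite psi_ls add0r => psia.
    rewrite le_eqVlt => lls; exists ls, (ls + del), ls; split => //.
      have {lls} [->//|lls] := predU1P lls.
      have := tangent _ _ Lls Ll; rewrite lt_eqF// => /(_ isT).
      have := tangent _ _ Ll Lls; rewrite gt_eqF// => /(_ isT) h1 h2.
      rewrite ltW// -(@ltr_pM2r _ (ls - l)) ?subr_gt0//; lra.
    split; last by rewrite -addrA ltrDl subr_gt0 ltr_pdivrMr.
      have := tangent _ _ Lls La; rewrite gt_eqF ?ltrDl// => /(_ isT).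
      by rewrite psi_ls add0r [ls + del]addrC addrK; apply/lt_trans/mulr_gt0.
    by rewrite psi_ls subr0.
  exists l, l, (l - psi l / psi' l); split => //; split.
  - have := tangent _ _ Lls Ll; rewrite gt_eqF// => /(_ isT).
    by rewrite psi_ls add0r; apply: lt_trans; rewrite mulr_gt0 ?subr_gt0.
  - by rewrite mulrBl divfK ?gt_eqF.
  have psil : 0 < psi l.
    have := tangent _ _ Lls Ll; rewrite gt_eqF// => /(_ isT).
    by rewrite psi_ls add0r; apply: lt_trans; rewrite mulr_gt0 ?subr_gt0.
  by rewrite ltrD2l ltrN2 ltr_pM2l// ltf_pV2 ?posrE// ltr_pMl.
(* Midpoint between the rate [rho] of the denominator and the Chernoff rate of the numerator at b =
   psi'(l). *)
pose r := (rho + (a - psi a / (k * psi' l))) / 2.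
have rhor : rho < r by rewrite midf_lt.
have ra : r < a - psi a / (k * psi' l) by rewrite midf_lt.
have ar0 : 0 < a - r.
  rewrite subr_gt0 (lt_trans ra)// gtrBl divr_gt0//.
have kar : 0 < k * (a - r) by rewrite mulr_gt0.
(* The last required inequality amounts to b > psi(a) / (k (a - r)); [b] is the midpoint between
   this threshold and psi'(l). *)
pose b := (psi a / (k * (a - r)) + psi' l) / 2.
have mv : psi a / (k * (a - r)) < psi' l.
  move: ra; rewrite ltrBrDr -ltrBrDl !ltr_pdivrMr//.
  by rewrite mulrCA mulrA [psi' l * _]mulrC.
have mb : psi a / (k * (a - r)) < b by rewrite midf_lt.
have b0 : 0 < b by rewrite (@lt_trans _ _ (psi a / (k * (a - r))))// divr_gt0.
have bv : b < psi' l by rewrite midf_lt.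
have kb0 : 0 < k * b by exact: mulr_gt0.
exists l0, a, r, b; split; split => //.
- by rewrite rhoE ltr_pM2r// (lt_le_trans v0).
- rewrite ltrBrDr -ltrBrDl ltr_pdivrMr//.
  move: mb; rewrite ltr_pdivrMr//.
  by rewrite (_ : b * (k * (a - r)) = (a - r) * (k * b))//; ring.
Qed.

(** * Linear bounds between x and B(x) *)

Section L_class_bounds.
Context (R : realType) (d : measure_display) (T : measurableType d).
Context (P : probability T R) (X : {RV P >-> R}).

Lemma L_class_near (l : R) (B : R -> R) : L_class P X l B ->
  forall e, 0 < e -> \forall x \near +oo,
    0 <= B x /\ `|x - derive1 (psi P X) l * B x| <= e * Num.sqrt (B x).
Proof.
case=> B0 /funext Bo e e0.
have := Bo => /eqaddoP /(_ _ e0) H.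
near=> x; split; first by near: x.
have : `|x - derive1 (psi P X) l * B x| <= e * `|Num.sqrt (B x)|.
  by near: x; exact: H.
by rewrite (ger0_norm (sqrtr_ge0 _)).
Unshelve. all: by end_near.
Qed.

Lemma sqrtr_le_id (y : R) : 1 <= y -> Num.sqrt y <= y.
Proof.
move=> y1; have y0 : 0 <= y by lra.
rewrite -{2}(sqr_sqrtr y0) expr2 ler_peMl ?sqrtr_ge0//.
by rewrite -sqrtr1 ler_sqrt// ltr01.
Qed.

(** Take e = a - psi'(l). Where B >= 1 the remainder is at most e B, since sqrt B <= B; where B < 1
    the point [x] would stay bounded. *)
Lemma L_class_near_le (l a : R) (B : R -> R) : L_class P X l B ->
  0 < a -> derive1 (psi P X) l < a -> \forall x \near +oo, x <= a * B x.
Proof.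
move=> LB a0; move: (L_class_near LB); move: (derive1 _ l) => v BH va.
have /BH {}BH : 0 < a - v by rewrite subr_gt0.
near=> x.
have [B0] : 0 <= B x /\ `|x - v * B x| <= (a - v) * Num.sqrt (B x) by near: x.
rewrite ler_norml => /andP[_ xB].
have : `|v| + a - v < x by near: x; apply: nbhs_pinfty_gt; exact: num_real.
have [B1|B1] := leP 1 (B x).
  have := sqrtr_le_id B1; move: (Num.sqrt _) xB => s xB sB _; nra.
have : Num.sqrt (B x) <= 1 by rewrite -sqrtr1 ler_sqrt// ltW.
have := ler_norm v; have : v * B x <= `|v|.
  rewrite (le_trans (ler_norm _))// normrM ler_piMr// ger0_norm// ltW//.
move: (Num.sqrt _) xB => s xB; nra.
Unshelve. all: by end_near.
Qed.

Lemma L_class_near_ge (l a : R) (B : R -> R) : L_class P X l B ->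
  0 < a -> a < derive1 (psi P X) l -> \forall x \near +oo, a * B x <= x.
Proof.
move=> LB a0; move: (L_class_near LB); move: (derive1 _ l) => v BH va.
have /BH {}BH : 0 < v - a by rewrite subr_gt0.
near=> x.
have [B0] : 0 <= B x /\ `|x - v * B x| <= (v - a) * Num.sqrt (B x) by near: x.
rewrite ler_norml => /andP[xB _].
have : a < x by near: x; apply: nbhs_pinfty_gt; exact: num_real.
have [B1|B1] := leP 1 (B x); last by nra.
have := sqrtr_le_id B1; move: (Num.sqrt _) xB => s xB sB _; nra.
Unshelve. all: by end_near.
Qed.

(** A slope [a] strictly between psi'(l) and [w] gives B >= x / a, and x / a - x / w eventually
    exceeds 1. *)
Lemma L_class_near_gt1D (l w : R) (B : R -> R) : L_class P X l B ->
  0 < w -> derive1 (psi P X) l < w -> \forall x \near +oo, x / w + 1 <= B x.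
Proof.
move=> LB w0; have H a := @L_class_near_le l a B LB.
move: (derive1 _ l) H => v H vw.
have [a [a0 va aw]] := exists_between_max vw w0.
have {}H := H _ a0 va.
near=> x.
have : x <= a * B x by near: x.
(* The threshold is the point where x / a - x / w reaches 1. *)
have : w / (w - a) * a <= x by near: x; apply: nbhs_pinfty_ge; exact: num_real.
move=> h1 h2.
rewrite -lerBrDr ler_pdivrMr//.
have wa : 0 < w - a by rewrite subr_gt0.
have h3 : w * a <= x * (w - a) by move: h1; rewrite mulrAC ler_pdivrMr.
have : a * x <= a * ((B x - 1) * w) by nra.
by rewrite ler_pM2l.
Unshelve. all: by end_near.
Qed.

End L_class_bounds.

(** * Partial sums of geometric series *)

Section geometric.
Context (R : realFieldType).

Lemma geometric_sum_lt1 (rho : R) (m n : nat) : 0 <= rho < 1 ->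
  \sum_(m <= t < n) rho ^+ t <= rho ^+ m / (1 - rho).
Proof.
move=> /andP[r0 r1]; have r10 : 0 < 1 - rho by rewrite subr_gt0.
rewrite ler_pdivlMr//; have [mn|nm] := leqP m n; last first.
  by rewrite big_geq ?mul0r ?exprn_ge0// ltnW.
have := telescope_sumr (fun t => - rho ^+ t) mn.
rewrite mulr_suml => sumE.
rewrite (eq_bigr (fun t => - rho ^+ t.+1 - - rho ^+ t)) ?sumE.
  by have := exprn_ge0 n r0; lra.
by move=> t _; rewrite exprS; ring.
Qed.

Lemma geometric_sum_gt1 (rho : R) (n : nat) : 1 < rho ->
  \sum_(0 <= t < n) rho ^+ t <= rho ^+ n / (rho - 1).
Proof.
move=> r1; have r10 : 0 < rho - 1 by rewrite subr_gt0.
rewrite ler_pdivlMr//.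
have := telescope_sumr (fun t => rho ^+ t) (leq0n n).
rewrite mulr_suml => sumE.
rewrite (eq_bigr (fun t => rho ^+ t.+1 - rho ^+ t)) ?sumE.
  by rewrite expr0; lra.
by move=> t _; rewrite exprS; ring.
Qed.

End geometric.

Lemma expR_ratio_cvg0 (R : realType) (f q : R -> R) (K C r r' : R) :
    0 < C -> r < r' ->
    (\forall x \near +oo, 0 <= f x <= K * expR (- (r' * x))) ->
    (\forall x \near +oo, C * expR (- (r * x)) <= q x) ->
  f x / q x @[x --> +oo] --> 0.
Proof.
move=> C0 rr fH qH.
have e0 : expR (- ((r' - r) * x)) @[x --> +oo] --> (0 : R).
  have : (r' - r) * x @[x --> +oo] --> +oo.
    by apply: gt0_cvgMry => //; rewrite subr_gt0.
  by move=> h; exact: (cvg_comp _ (fun y => expR (- y)) h (@cvgr_expR R)).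
apply: (@squeeze_cvgr _ _ _ _ (cst 0)
  (fun x => K / C * expR (- ((r' - r) * x)))).
- near=> x.
  have /andP[f0 fK] : 0 <= f x <= K * expR (- (r' * x)) by near: x.
  have qC : C * expR (- (r * x)) <= q x by near: x.
  have q0 : 0 < q x by rewrite (lt_le_trans _ qC)// mulr_gt0 ?expR_gt0.
  rewrite divr_ge0 ?(ltW q0)//= ler_pdivrMr//.
  apply: (le_trans fK).
  have -> : K * expR (- (r' * x)) =
      K / C * expR (- ((r' - r) * x)) * (C * expR (- (r * x))).
    rewrite mulrACA divfK ?gt_eqF// -expRD; congr (_ * expR _); ring.
  rewrite ler_wpM2l// !mulr_ge0 ?expR_ge0 ?invr_ge0 ?(ltW C0)//.
  (* K >= 0 follows from the bounds on [f] themselves. *)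
  have := le_trans f0 fK; rewrite pmulr_lge0 ?expR_gt0//.
- exact: cvg_cst.
- rewrite -[X in _ --> X](mulr0 (K / C)).
  by apply: cvgM => //; exact: cvg_cst.
Unshelve. all: by end_near.
Qed.

(** * Chernoff bounds on hitting probabilities *)

Section hitting_upper_bounds.
Context (R : realType) (d : measure_display) (T : measurableType d).
Context (P : probability T R) (X : {RV P >-> R}) (xi : nat -> {RV P >-> R}).
Context (xi_indep : mutually_independent P (fun i => xi i : T -> R)).
Context (xi_law : forall i, same_law P (xi i) X).

Lemma hit_prob_ge0 x c : 0 <= hit_prob xi x c.
Proof. exact: fine_ge0. Qed.

Lemma hit_prob_le1 x c : hit_prob xi x c <= 1.
Proof.
rewrite -lee_fin fineK; last first.
  by apply: fin_num_measure; exact: measurable_hitting_time_le.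
by apply: probability_le1; exact: measurable_hitting_time_le.
Qed.

Lemma hit_prob_le x c c' : c <= c' -> hit_prob xi x c <= hit_prob xi x c'.
Proof.
move=> cc'; have mc := measurable_hitting_time_le xi x.
apply: fine_le; [exact: fin_num_measure|exact: fin_num_measure|].
apply: le_measure; rewrite ?inE//.
by move=> w /= /le_trans; apply; rewrite lee_fin.
Qed.

(** Hitting in the window from [c] to [c'] forces the walk above [x] at some time t > c. As phi(a) <
    1, the Chernoff terms sum to a multiple of the first one, uniformly in [c']. *)
Lemma hit_prob_diff_le (a x c c' : R) : 0 <= a -> Lambda P X a ->
    psi P X a < 0 -> 0 <= c -> c <= c' ->
  hit_prob xi x c' - hit_prob xi x c <=
  (1 - phi P X a)^-1 * expR (- (a * x) + c * psi P X a).
Proof.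
move=> a0 La psi0 c0 cc'; have mc := measurable_hitting_time_le xi x.
(* First integer strictly above [c]; as psi(a) < 0, phi(a)^m <= exp (c psi(a)). *)
pose m := (Num.truncn c).+1.
set A := [set w | (hitting_time (walk (fun n => xi n : T -> R)) x w <= c'%:E)%E]
  `\` [set w | (hitting_time (walk (fun n => xi n : T -> R)) x w <= c%:E)%E].
have mA : measurable A by exact: measurableD.
have -> : hit_prob xi x c' - hit_prob xi x c = fine (P A).
  rewrite /hit_prob -fineB; [|exact: fin_num_measure..].
  rewrite /A measureD//; last by rewrite ltey_eq fin_num_measure.
  congr (fine (_ - P _)); apply/seteqP; split=> [w /= tc|w []//].
  by split => //; rewrite (le_trans tc)// lee_fin.
have phia_lt1 : phi P X a < 1 by rewrite phi_lt1.
have phi0 := phi_gt0 La.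
apply: (le_trans (chernoff_union xi_indep xi_law (x := x) (m := m)
  (n := (Num.truncn c').+1) a0 La mA _)).
  move=> w [/hitting_time_leP[t tc' xt] tc]; exists t => //.
  rewrite ltnS truncn_ge_nat ?(le_trans c0)// tc' andbT.
  rewrite /m truncn_lt_nat// ltNge; apply/negP => tc0; apply: tc.
  by apply/hitting_time_leP; exists t.
rewrite expRD [leRHS]mulrCA ler_wpM2l ?expR_ge0//.
apply: le_trans (geometric_sum_lt1 _ _ _) _; first by rewrite (ltW phi0).
rewrite mulrC ler_wpM2l ?invr_ge0 ?subr_ge0 ?(ltW phia_lt1)//.
rewrite -expR_psi// -expRM_natl ler_expR ler_wnM2r ?(ltW psi0)//.
exact/ltW/truncnS_gt.
Qed.

(** As phi(a) < 1, the Chernoff terms over all times are summable, which makes the bound uniform in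
    [c]. *)
Lemma hit_prob_le_lt1 (a x c : R) : 0 <= a -> Lambda P X a ->
    psi P X a < 0 ->
  hit_prob xi x c <= (1 - phi P X a)^-1 * expR (- (a * x)).
Proof.
move=> a0 La psi0; have mc := measurable_hitting_time_le xi x.
have phia_lt1 : phi P X a < 1 by rewrite phi_lt1.
have phi0 := phi_gt0 La.
apply: (le_trans (chernoff_union xi_indep xi_law (x := x) (m := 0)
  (n := (Num.truncn c).+1) a0 La (mc c) _)).
  move=> w /hitting_time_leP[t tc xt]; exists t => //=.
  by rewrite ltnS truncn_ge_nat// (le_trans _ tc).
rewrite [leRHS]mulrC ler_wpM2l ?expR_ge0//.
apply: le_trans (geometric_sum_lt1 _ _ _) _; first by rewrite (ltW phi0).
by rewrite expr0 mul1r.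
Qed.

(** As phi(a) > 1, the sum is governed by its upper limit truncn c + 1 <= c + 1; the added 1 is paid
    by the factor [expR (psi P X a)]. *)
Lemma hit_prob_le_gt1 (a x c : R) : 0 <= a -> Lambda P X a ->
    0 < psi P X a -> 0 <= c ->
  hit_prob xi x c <=
  (phi P X a - 1)^-1 * expR (psi P X a) * expR (- (a * x) + c * psi P X a).
Proof.
move=> a0 La psi0 c0; have mc := measurable_hitting_time_le xi x.
have phia_gt1 : 1 < phi P X a by rewrite phi_gt1.
apply: (le_trans (chernoff_union xi_indep xi_law (x := x) (m := 0)
  (n := (Num.truncn c).+1) a0 La (mc c) _)).
  move=> w /hitting_time_leP[t tc xt]; exists t => //=.
  by rewrite ltnS truncn_ge_nat.
rewrite expRD [leRHS]mulrCA ler_wpM2l ?expR_ge0//.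
apply: le_trans (geometric_sum_gt1 _ _) _ => //.
rewrite mulrC -mulrA ler_wpM2l ?invr_ge0 ?subr_ge0 ?(ltW phia_gt1)//.
rewrite -{1}expR_psi// -expRM_natl -expRD ler_expR -natr1 mulrDl mul1r addrC.
by rewrite lerD2l ler_wpM2r ?truncn_le// ltW.
Qed.

End hitting_upper_bounds.

(** * Law of the minimum of independent times *)

Section min_time_distribution.
Context (R : realType) (d : measure_display) (T : measurableType d).
Context (P : probability T R) (N : nat) (tau : 'I_N -> {RV P >-> \bar R}).
Context (tau_indep : mutually_independent P (fun i => tau i : T -> \bar R)).

(** The minimum exceeds [c] exactly when all [N] times do, and independence turns this into a
    product of [N] equal factors 1 - p. *)
Lemma fine_prob_min_time_le (c p : R) :
    (forall i, fine (P [set w | (tau i w <= c%:E)%E]) = p) ->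
  fine (P [set w | (min_time (fun i => tau i : T -> \bar R) w <= c%:E)%E]) =
  1 - (1 - p) ^+ N.
Proof.
move=> tauP; pose A (i : 'I_N) : set (\bar R) := [set y | (c%:E < y)%E].
have mA i : measurable (A i).
  rewrite (_ : A i = `]c%:E, +oo[%classic); first exact: emeasurable_itv.
  by apply/seteqP; split=> y /=; rewrite in_itv/= andbT.
have mtau i : measurable (tau i @^-1` A i) by exact: measurable_funPTI.
have PA i : P (tau i @^-1` A i) = (1 - p)%:E.
  have -> : tau i @^-1` A i = ~` [set w | (tau i w <= c%:E)%E].
    by apply/seteqP; split=> w /=; rewrite /A/= ltNge => /negP.
  have mC : measurable [set w | (tau i w <= c%:E)%E].
    rewrite -[X in measurable X]setCK; apply: measurableC.
    rewrite (_ : ~` _ = tau i @^-1` A i)//.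
    by apply/seteqP; split=> w /=; rewrite /A/= ltNge => /negP.
  by rewrite probability_setC// EFinB -(tauP i) fineK// fin_num_measure.
pose J : {fset 'I_N} := [fset i in 'I_N]%fset.
have JT i : i \in J by rewrite !inE.
set S := [set w | _].
have capE : \bigcap_(i in [set` J]) (tau i @^-1` A i) = ~` S.
  apply/seteqP; split=> w /=.
    move=> Aw; apply/negP; rewrite -ltNge; apply/bigmin_gtP; split.
      by rewrite ltry.
    by move=> i _; exact: (Aw i (JT i)).
  by move=> /negP; rewrite -ltNge => /bigmin_gtP[_ Aw] i _; exact: Aw.
have mS : measurable S.
  rewrite -[S]setCK -capE; apply: measurableC; apply: fin_bigcap_measurable.
    exact: finite_fset.
  by move=> i _; exact: mtau.
have := tau_indep J mA; rewrite capE.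
rewrite (perm_big (index_enum 'I_N)); last first.
  by apply: uniq_perm; rewrite ?index_enum_uniq ?fset_uniq// => i;
    rewrite mem_index_enum JT.
rewrite (eq_bigr (fun=> (1 - p)%:E)) => [|i _]; last exact: PA.
rewrite prodEFin prodr_const card_ord => PS.
have := etrans (esym (probability_setC P mS)) PS.
rewrite -[P S]fineK ?fin_num_measure// -EFinB => -[] <-.
by rewrite opprB addrC subrK.
Qed.

End min_time_distribution.

(** Induction through 1 - (1 - p) y = p + (1 - p) (1 - y). The coefficient n^2, cruder than the
    binomial one, leaves an explicit nonnegative remainder. *)
Lemma complement_expn_bounds (R : realFieldType) (p : R) (n : nat) :
    0 <= p <= 1 ->
  n%:R * p - n%:R ^+ 2 * p ^+ 2 <= 1 - (1 - p) ^+ n <= n%:R * p.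
Proof.
move=> /andP[p0 p1]; elim: n => [|n /andP[IH1 IH2]].
  by rewrite expr0 expr0n/= !mul0r !subrr lexx.
have n0 : 0 <= n%:R :> R by [].
rewrite (exprS (1 - p)) -natr1; move: ((1 - p) ^+ n) IH1 IH2 n0 => y.
move: (n%:R : R) => k h1 h2 k0.
have -> : 1 - (1 - p) * y = p + (1 - p) * (1 - y) by ring.
have h5 : 0 <= k * p ^+ 2 by rewrite mulr_ge0 ?exprn_ge0.
have h7 : (1 - p) * (1 - y) <= (1 - p) * (k * p).
  by rewrite ler_wpM2l// subr_ge0.
apply/andP; split; last first.
  by move: h7; rewrite [_ * (k * p)](_ : _ = k * p - k * p ^+ 2); [lra|ring].
have h3 : (1 - p) * (k * p - k ^+ 2 * p ^+ 2) <= (1 - p) * (1 - y).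
  by rewrite ler_wpM2l// subr_ge0.
have h4 : 0 <= k ^+ 2 * p ^+ 2 * p by rewrite !mulr_ge0 ?exprn_ge0.
have h6 : 0 <= p ^+ 2 by rewrite exprn_ge0.
have -> : (k + 1) * p - (k + 1) ^+ 2 * p ^+ 2 =
  p + (1 - p) * (k * p - k ^+ 2 * p ^+ 2) -
    (k ^+ 2 * p ^+ 2 * p + k * p ^+ 2 + p ^+ 2) by ring.
lra.
Qed.

(** Write p / q = 1 - (q - p) / q. The second-order error n^2 p^2 / q is at most n^2 p because p <=
    q, so both errors vanish. *)
Lemma cvg_complement_expn_ratio (R : realType) (p q : R -> R) (n : nat) :
    (\forall x \near +oo, [/\ 0 <= p x, p x <= q x, q x <= 1 & 0 < q x]) ->
    p x @[x --> +oo] --> 0 -> (q x - p x) / q x @[x --> +oo] --> 0 ->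
  (1 - (1 - p x) ^+ n) / q x @[x --> +oo] --> (n%:R : R).
Proof.
move=> pq p_0 qp_0.
apply: (@squeeze_cvgr _ _ _ _
  (fun x => n%:R - n%:R * ((q x - p x) / q x) - n%:R ^+ 2 * p x) (cst n%:R)).
- near=> x.
  have [p0 pqx q1 q0] : [/\ 0 <= p x, p x <= q x, q x <= 1 & 0 < q x].
    by near: x.
  have p01 : 0 <= p x <= 1 by rewrite p0 (le_trans pqx).
  have /andP[lo up] := complement_expn_bounds n p01.
  have n0 : 0 <= n%:R :> R by [].
  rewrite ler_pdivlMr// ler_pdivrMr//; apply/andP; split; last first.
    by rewrite (le_trans up)// ler_wpM2l.
  apply: le_trans lo.
  have -> : (n%:R - n%:R * ((q x - p x) / q x) - n%:R ^+ 2 * p x) * q x =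
      n%:R * p x - n%:R ^+ 2 * (p x * q x).
    by field; rewrite gt_eqF.
  have : n%:R ^+ 2 * (p x ^+ 2) <= n%:R ^+ 2 * (p x * q x).
    by rewrite ler_wpM2l ?exprn_ge0// expr2 ler_wpM2l.
  by lra.
- rewrite -[X in _ --> X]subr0 -[X in _ --> X - _]subr0.
  apply: cvgB; last by rewrite -(mulr0 (n%:R ^+ 2)); apply: cvgMr.
  apply: cvgB; first exact: cvg_cst.
  by rewrite -(mulr0 n%:R); apply: cvgMr.
- exact: cvg_cst.
Unshelve. all: by end_near.
Qed.

Lemma expR_bounded_cvg0 (R : realType) (p : R -> R) (K a : R) : 0 < a ->
    (\forall x \near +oo, 0 <= p x <= K * expR (- (a * x))) ->
  p x @[x --> +oo] --> 0.
Proof.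
move=> a0 pK.
have := @expR_ratio_cvg0 _ p (cst 1) K 1 0 a ltr01 a0 pK.
rewrite /= (_ : (fun x => p x / 1) = p); last first.
  by apply/funext => x; rewrite divr1.
by apply; apply: nearW => x; rewrite mul0r oppr0 expR0 mulr1.
Qed.

(** * The two regimes *)

Section regimes.
Context (R : realType) (d : measure_display) (T : measurableType d).
Context (P : probability T R) (X : {RV P >-> R}) (xi : nat -> {RV P >-> R}).
Context (xi_indep : mutually_independent P (fun i => xi i : T -> R)).
Context (xi_law : forall i, same_law P (xi i) X).
Context (X_nonconst : ~ exists c : R, {ae P, forall w, X w = c}).
Context (phi_diff2 : forall l, Lambda_plus P X l ->
  derivable (phi P X) l 1 /\ derivable (derive1 (phi P X)) l 1).
Context (lstar : R) (lstar_in : Lambda_plus P X lstar).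
Context (psi_lstar : psi P X lstar = 0).
Context (l : R) (l_in : Lambda_plus P X l).
Context (B : R -> R) (B_in : L_class P X l B).
Context (N : nat) (N_ge2 : (2 <= N)%N).

Let p x := hit_prob xi x (B x / N%:R).
Let q x := hit_prob xi x (B x).

Let N0 : 0 < N%:R :> R.
Proof. by rewrite ltr0n; exact: leq_trans N_ge2. Qed.

Let N1 : 1 < N%:R :> R.
Proof. by rewrite ltr1n. Qed.

Let B_ge0 : \forall x \near +oo, 0 <= B x.
Proof. by case: B_in. Qed.

(** A speed v > psi'(l0) >= psi'(l) satisfies x / v + 1 <= B(x) eventually, so the lower bound
    applies at time B(x). *)
Lemma hit_prob_lower_bound_near (l0 r : R) : Lambda_plus P X l0 ->
    l0 * derive1 (psi P X) l0 - psi P X l0 < r * derive1 (psi P X) l0 ->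
    0 < derive1 (psi P X) l0 -> derive1 (psi P X) l <= derive1 (psi P X) l0 ->
  exists2 C, 0 < C & \forall x \near +oo, C * expR (- (r * x)) <= q x.
Proof.
move=> Ll0 r0 v0 ll0.
have [v v0v [C C0 H]] := hit_prob_lower_bound xi_indep xi_law X_nonconst
  phi_diff2 Ll0 r0 v0.
exists C => //.
have BH := L_class_near_gt1D B_in (lt_trans v0 v0v) (le_lt_trans ll0 v0v).
near=> x; have Hx : forall c, x / v + 1 <= c ->
  C * expR (- (r * x)) <= hit_prob xi x c by near: x.
by apply: Hx; near: x.
Unshelve. all: by end_near.
Qed.

Lemma slow_regime_cvg :
    N%:R * derive1 (psi P X) l < derive1 (psi P X) lstar ->
  (1 - (1 - p x) ^+ N) / q x @[x --> +oo] --> (N%:R : R).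
Proof.
move=> Nv.
have v_gt0 := derive1_psi_zero_gt0 X_nonconst phi_diff2 lstar_in psi_lstar.
(* If psi'(l) were larger than psi'(lstar) > 0, so would be N psi'(l). *)
have v_le : derive1 (psi P X) l <= derive1 (psi P X) lstar.
  by move: Nv v_gt0; move: (derive1 _ l) (derive1 _ lstar) N1 => v w n1; nra.
have [u [u0 ul ulstar]] : exists u, [/\ 0 < u, N%:R * derive1 (psi P X) l < u &
    u < derive1 (psi P X) lstar].
  exact: exists_between_max.
(* Moving left from [lstar] by [del] lowers psi by more than del u, which makes a - psi(a) / u
   exceed lstar. *)
have [del [del0 La psia]] : exists del, [/\ 0 < del,
    Lambda_plus P X (lstar - del) & psi P X (lstar - del) < - (del * u)].
  have dir := near_directional_lt (derivable_psi phi_diff2 lstar_in)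
    (ltac:(rewrite mulrN1 ltrN2; exact: ulstar) :
      derive1 (psi P X) lstar * -1 < - u).
  have NL := near_Lambda_plus (-1) lstar_in.
  near (0 : R)^'+ => del; exists del; split.
  - by near: del; exact: nbhs_right_gt.
  - by rewrite -[del]mulr1 -mulrN; near: del.
  - have : psi P X (lstar + del * -1) < psi P X lstar + del * - u by near: del.
    by rewrite mulrN1 psi_lstar add0r mulrN.
have a0 := Lambda_plus_gt0 La.
set a := lstar - del in La psia a0.
have psia0 : psi P X a < 0 by rewrite (lt_trans psia)// oppr_lt0 mulr_gt0.
(* Decay rate of the event B / N < tau <= B, given B / N >= x / u. The [r] chosen next separates it
   from the rate lstar of the denominator. *)
pose r' := a - psi P X a / u.
have rr : lstar < r'.
  by rewrite /r' /a -addrA ltrDl subr_gt0 ltr_pdivrMr// mulNr.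
have [r lr rr'] : exists2 r, lstar < r & r < r'.
  by exists ((lstar + r') / 2); rewrite midf_lt.
have rate : lstar * derive1 (psi P X) lstar - psi P X lstar <
    r * derive1 (psi P X) lstar by rewrite psi_lstar subr0 ltr_pM2r.
have [C C0 qC] := hit_prob_lower_bound_near lstar_in rate v_gt0 v_le.
pose K := (1 - phi P X a)^-1.
have phia_lt1 : phi P X a < 1 by rewrite phi_lt1//; exact: Lambda_plus_sub.
have K0 : 0 < K by rewrite invr_gt0 subr_gt0.
have Bu : \forall x \near +oo, x <= u / N%:R * B x.
  apply: (L_class_near_le B_in); first exact: divr_gt0.
  by rewrite ltr_pdivlMr// mulrC.
apply: cvg_complement_expn_ratio.
- near=> x; have B0 : 0 <= B x by near: x.
  split.
  + exact: hit_prob_ge0.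
  + by apply: hit_prob_le; rewrite ler_pdivrMr// ler_peMr// ltW.
  + exact: hit_prob_le1.
  + have : C * expR (- (r * x)) <= q x by near: x.
    by apply: lt_le_trans; rewrite mulr_gt0 ?expR_gt0.
- apply: (expR_bounded_cvg0 (K := K) a0); apply: nearW => x.
  rewrite hit_prob_ge0/=; apply: (hit_prob_le_lt1 xi_indep xi_law) => //.
  + exact: ltW.
  + exact: Lambda_plus_sub.
- apply: (expR_ratio_cvg0 (K := K) C0 rr') => //.
  near=> x; have B0 : 0 <= B x by near: x.
  have xB : x <= u / N%:R * B x by near: x.
  have BB : B x / N%:R <= B x by rewrite ler_pdivrMr// ler_peMr// ltW.
  rewrite subr_ge0 hit_prob_le//=.
  apply: (le_trans (hit_prob_diff_le xi_indep xi_law x (ltW a0)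
    (Lambda_plus_sub La) psia0 (divr_ge0 B0 (ltW N0)) BB)).
  rewrite ler_wpM2l ?(ltW K0)// ler_expR /r'.
  move: psia0; move: (psi P X a) => s s0.
  have : x / u <= B x / N%:R.
    by rewrite ler_pdivrMr// mulrAC [B x * u]mulrC mulrAC.
  (* Multiplying by psi(a) < 0 reverses the comparison of x / u with B / N. *)
  move=> /(ler_wnM2r (ltW s0)) Bs.
  rewrite (mulrBl x a) opprB addrC lerD2r (le_trans Bs)//.
  by rewrite [leLHS]mulrAC [leRHS]mulrAC [s * x]mulrC.
Unshelve. all: by end_near.
Qed.

Lemma fast_regime_cvg :
    derive1 (psi P X) lstar < N%:R * derive1 (psi P X) l ->
  (1 - (1 - p x) ^+ N) / q x @[x --> +oo] --> (0 : R).
Proof.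
move=> Nv.
have vs_gt0 := derive1_psi_zero_gt0 X_nonconst phi_diff2 lstar_in psi_lstar.
have tangent x y : Lambda_plus P X x -> Lambda_plus P X y -> y != x ->
    psi P X x + derive1 (psi P X) x * (y - x) < psi P X y.
  by move=> Lx /Lambda_plus_sub; exact: psi_tangent_lt.
have right c : derive1 (psi P X) lstar < c -> exists del, [/\ 0 < del,
    Lambda_plus P X (lstar + del) &
    psi P X (lstar + del) < psi P X lstar + del * c].
  rewrite -[derive1 _ lstar]mulr1 => vc.
  have dir := near_directional_lt (derivable_psi phi_diff2 lstar_in) vc.
  have NL := near_Lambda_plus 1 lstar_in.
  near (0 : R)^'+ => del; exists del; split.
  - by near: del; exact: nbhs_right_gt.
  - by rewrite -[del]mulr1; near: del.
  - by rewrite -{1}[del]mulr1; near: del.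
have [l0 [a [r [b [[Ll0 La ll0] [psia rate b0 bv br]]]]]] :=
  fast_rates tangent right lstar_in l_in psi_lstar vs_gt0 N1 Nv.
have a0 := Lambda_plus_gt0 La.
have v0_gt0 := lt_le_trans (lt_trans b0 bv) ll0.
have [C C0 qC] := hit_prob_lower_bound_near Ll0 rate v0_gt0 ll0.
have Bb := L_class_near_ge B_in b0 bv.
pose K := (phi P X a - 1)^-1 * expR (psi P X a).
have phia_gt1 : 1 < phi P X a by rewrite phi_gt1//; exact: Lambda_plus_sub.
have K0 : 0 < K by rewrite mulr_gt0 ?expR_gt0// invr_gt0 subr_gt0.
apply: (expR_ratio_cvg0 (K := N%:R * K) C0 br) => //.
near=> x; have B0 : 0 <= B x by near: x.
have bx : b * B x <= x by near: x.
have p01 : 0 <= p x <= 1 by rewrite hit_prob_ge0 hit_prob_le1.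
have /andP[_ up] := complement_expn_bounds N p01.
have /andP[p0 p1] := p01.
rewrite subr_ge0 exprn_ile1 ?subr_ge0 ?gerBl//=.
apply: (le_trans up); rewrite -mulrA ler_pM2l//.
apply: (le_trans (hit_prob_le_gt1 xi_indep xi_law x (ltW a0)
  (Lambda_plus_sub La) psia (divr_ge0 B0 (ltW N0)))).
rewrite -/K ler_pM2l// ler_expR.
move: psia; move: (psi P X a) => s s0.
(* With psi(a) > 0, this turns the Chernoff exponent into -x (a - psi(a) / (N b)), whose rate
   exceeds [r]. *)
have : B x / N%:R <= x / (N%:R * b).
  by rewrite ler_pdivlMr ?mulr_gt0// mulrA divfK ?gt_eqF// mulrC.
move=> /(ler_wpM2r (ltW s0)) Bs.
rewrite (mulrBl x a) opprB addrC lerD2r (le_trans Bs)//.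
by rewrite [leLHS]mulrAC [leRHS]mulrAC [s * x]mulrC.
Unshelve. all: by end_near.
Qed.

End regimes.

Theorem theorem1 (R : realType) (d : measure_display) (T : measurableType d)
    (P : probability T R)
    (X : {RV P >-> R}) (xi : nat -> {RV P >-> R})
    (xi_indep : mutually_independent P (fun i => xi i : T -> R))
    (xi_law : forall i, same_law P (xi i) X)
    (X_nonconst : ~ exists c : R, {ae P, forall w, X w = c})
    (X_pos : (0 < P [set w | (0 < X w)%R])%E)
    (X_neg : (0 < P [set w | (X w < 0)%R])%E)
    (Lambda_plus_neq0 : Lambda_plus P X !=set0)
    (phi_diff2 : forall l, Lambda_plus P X l ->
       derivable (phi P X) l 1 /\ derivable (derive1 (phi P X)) l 1)
    (lstar : R) (lstar_in : Lambda_plus P X lstar)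
    (psi_lstar : psi P X lstar = 0)
    (l : R) (l_in : Lambda_plus P X l)
    (B : R -> R) (B_in : L_class P X l B)
    (N : nat) (N_ge2 : (2 <= N)%N)
    (tau_ : 'I_N -> R -> {RV P >-> \bar R})
    (tau_indep : forall x,
       mutually_independent P (fun i => tau_ i x : T -> \bar R))
    (tau_law : forall i x, same_law P (tau_ i x)
       (hitting_time (walk (fun n => xi n : T -> R)) x)) :
  let tau := hitting_time (walk (fun n => xi n : T -> R)) in
  let tauN x := min_time (fun i => tau_ i x : T -> \bar R) in
  let ratio x :=
    fine (P [set w | (tauN x w <= (B x / N%:R)%:E)%E]) /
    fine (P [set w | (tau x w <= (B x)%:E)%E]) in
  (N%:R * derive1 (psi P X) l < derive1 (psi P X) lstar ->
     ratio x @[x --> +oo] --> (N%:R : R)) /\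
  (derive1 (psi P X) lstar < N%:R * derive1 (psi P X) l ->
     ratio x @[x --> +oo] --> (0 : R)).
Proof.
move=> tau tauN ratio.
(* Each [tau_ i x] has the law of the hitting time, so the numerator depends on a single
   probability, [hit_prob] at B(x) / N. *)
have -> : ratio = fun x =>
    (1 - (1 - hit_prob xi x (B x / N%:R)) ^+ N) / hit_prob xi x (B x).
  apply/funext => x; rewrite /ratio; congr (_ / _).
  apply: fine_prob_min_time_le => // i; congr fine.
  have mA : measurable [set y : \bar R | (y <= (B x / N%:R)%:E)%E].
    rewrite (_ : [set _ | _] = `]-oo, (B x / N%:R)%:E]%classic).
      exact: emeasurable_itv.
    by apply/seteqP; split=> y /=; rewrite in_itv.
  exact: tau_law i x _ mA.
split=> Nv.
- exact: (slow_regime_cvg xi_indep xi_law X_nonconst phi_diff2 lstar_in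
    psi_lstar B_in N_ge2).
- exact: (fast_regime_cvg xi_indep xi_law X_nonconst phi_diff2 lstar_in
    psi_lstar l_in B_in N_ge2).
Qed.
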